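(* Let $A$ be a ring. Let $B$ be an $A$-algebra. Let $(I_\rho)_{\rho\in\mathbb{N}}$ be an ideal semifiltration of $A$. Let $x\in B$ and $y\in B$. Let $m\in\mathbb{N}$ and $n\in\mathbb{N}$. Assume that $x$ is $m$-integral over $\left(A,(I_\rho)_{\rho\in\mathbb{N}}\right)$, and that $y$ is $n$-integral over $A$. Then $xy$ is $nm$-integral over $\left(A,(I_\rho)_{\rho\in\mathbb{N}}\right)$.
   Context: All rings are commutative with unity, and ''$A$-algebra'' means commutative unital $A$-algebra (the structure map $A\to B$ need not be injective). $\mathbb{N}=\{0,1,2,\ldots\}$. For a ring $A$, an $A$-algebra $B$ and $n\in\mathbb{N}$, an element $u\in B$ is called $n$-integral over $A$ if there exists a monic polynomial $P\in A[X]$ with $\deg P=n$ (that is, $P=X^n+\sum_{k=0}^{n-1}a_kX^k$ with $a_k\in A$) and $P(u)=0$. An ideal semifiltration of a ring $A$ is a sequence $(I_\rho)_{\rho\in\mathbb{N}}$ of ideals of $A$ such that $I_0=A$ and $I_aI_b\subseteq I_{a+b}$ for all $a,b\in\mathbb{N}$. Given an ideal semifiltration $(I_\rho)_{\rho\in\mathbb{N}}$ of $A$, an element $u$ of an $A$-algebra $B$ is called $n$-integral over $(A,(I_\rho)_{\rho\in\mathbb{N}})$ if there exists $(a_0,a_1,\ldots,a_n)\in A^{n+1}$ such that $\sum_{k=0}^{n}a_ku^k=0$, $a_n=1$, and $a_i\in I_{n-i}$ for every $i\in\{0,1,\ldots,n\}$. *)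

(* Defs.v *)
From mathcomp Require Import all_boot all_order all_algebra.

Set Implicit Arguments.
Unset Strict Implicit.
Unset Printing Implicit Defensive.

Import GRing.Theory.
Local Open Scope ring_scope.

(* Zero rings are allowed (comPzRingType).  The library's {poly A}, its algebra
   structures (comAlgType A) and its ideals (idealr) all require nonzero rings,
   and idealr moreover only covers decidable proper ideals.  Hence ideals are
   Prop-valued predicates below, an A-algebra B is given by its structure
   morphism f : A -> B (not necessarily injective), and a monic polynomial of
   degree n is given by its coefficients of index < n. *)

Definition is_ideal (A : comPzRingType) (I : A -> Prop) : Prop :=
  [/\ I 0,
      forall x y, I x -> I y -> I (x + y)
    & forall a x, I x -> I (a * x)].

(* The product of two ideals consists of the finite sums of products. *)
Definition ideal_mul (A : comPzRingType) (I J : A -> Prop) : A -> Prop :=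
  fun z => exists (r : nat) (x y : 'I_r -> A),
    [/\ forall i, I (x i), forall i, J (y i) & z = \sum_(i < r) x i * y i].

Definition ideal_semifiltration (A : comPzRingType) (I : nat -> A -> Prop) :
    Prop :=
  [/\ forall rho, is_ideal (I rho),
      forall z, I 0%N z
    & forall a b z, ideal_mul (I a) (I b) z -> I (a + b)%N z].

(* u is a root of a monic polynomial X^n + \sum_(k < n) a_k X^k over A.  For
   n = 0 this says that 1 = 0 in B. *)
Definition n_integral (A B : comPzRingType) (f : {rmorphism A -> B}) (n : nat)
    (u : B) : Prop :=
  exists a : 'I_n -> A, u ^+ n + \sum_(k < n) f (a k) * u ^+ k = 0.

Definition n_integral_over (A B : comPzRingType) (f : {rmorphism A -> B})
    (I : nat -> A -> Prop) (n : nat) (u : B) : Prop :=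
  exists a : 'I_n.+1 -> A,
    [/\ \sum_(k < n.+1) f (a k) * u ^+ k = 0,
        a ord_max = 1
      & forall i : 'I_n.+1, I (n - i)%N (a i)].

(* Main.v *)
Require Import Defs.
From mathcomp Require Import all_boot all_order all_algebra.

Set Implicit Arguments.
Unset Strict Implicit.
Unset Printing Implicit Defensive.

Import GRing.Theory.
Local Open Scope ring_scope.

(** Write [u = x * y].  Let [P = \sum_(k <= m) a_k X^k], with [a_m = 1] and
    [a_k] in [I_(m - k)], be the polynomial given for [x], and let [C] be the
    companion matrix of the monic polynomial given for [y], so that the column
    [v] of the powers [1, y, ..., y^(n-1)] satisfies [C v = y v].  Homogenizing
    [P] in the direction of [C] gives the [n * n] matrix
      [D = \sum_(k <= m) a_k u^k C^(m - k)]
    which kills [v], because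
      [D v = (\sum_(k <= m) a_k x^k y^k y^(m - k)) v = y^m P(x) v = 0].
    Multiplying by the adjugate gives [det D * v = 0], and the first entry of
    [v] is [1], whence [det D = 0].  This is the required equation for [u]:
    every entry of [D] is a polynomial in [u] whose coefficient at [u^k] lies
    in [I_(m - k)], and the matrix of the coefficients at [u^m] is [C^0 = 1].
    Hence [det D] is a polynomial in [u] whose coefficient at [u^k] lies in
    [I_(n * m - k)] and whose coefficient at [u^(n * m)] is [det 1 = 1].

    The bookkeeping for the last step is the relation [graded_value], which
    records the degree and the top coefficient together; it is stable under
    sums ([graded_value_sum]), products ([graded_valueM]) and therefore
    determinants ([graded_value_det]). *)

(** * Values of homogeneous polynomials over the Rees algebra *)

(** Let [X] be a variable of degree 1 over the Rees algebra
    [\sum_rho I_rho T^rho].  Then [z] is the value at [T = 1], [X = u] of a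
    polynomial in [X] homogeneous of total degree [r], whose coefficient at
    [X^r] is [c].  The coefficient is a parameter of the relation since [z] does
    not determine it; taking [c = 1] and [z = 0] gives back
    integrality of [u] over the semifiltration. *)
Definition graded_value (A B : comPzRingType) (f : {rmorphism A -> B})
    (I : nat -> A -> Prop) (u : B) (r : nat) (c : A) (z : B) : Prop :=
  exists a : 'I_r.+1 -> A,
    [/\ \sum_(k < r.+1) f (a k) * u ^+ k = z,
        a ord_max = c
      & forall i : 'I_r.+1, I (r - i)%N (a i)].

Lemma semifiltrationM (A : comPzRingType) (I : nat -> A -> Prop)
    (hI : ideal_semifiltration I) (r s : nat) (a b : A) :
  I r a -> I s b -> I (r + s)%N (a * b).
Proof.
case: hI => _ _ hM Ia Ib; apply: hM.
exists 1%N, (fun=> a), (fun=> b); split=> //.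
by rewrite big_ord1.
Qed.

Section GradedValue.

Variables (A B : comPzRingType) (f : {rmorphism A -> B}).
Variables (I : nat -> A -> Prop) (hI : ideal_semifiltration I) (u : B).

Let G := graded_value f I u.

Lemma graded_value0 r : G r 0 0.
Proof.
case: hI => hid _ _; exists (fun=> 0); split=> // [|i].
  by rewrite big1 // => k _; rewrite rmorph0 mul0r.
by case: (hid (r - i)%N).
Qed.

Lemma graded_valueD r c d z w : G r c z -> G r d w -> G r (c + d) (z + w).
Proof.
case: hI => hid _ _ [a [<- <- Ia]] [b [<- <- Ib]].
exists (fun i => a i + b i); split=> // [|i].
  by rewrite -big_split; apply: eq_bigr => k _; rewrite rmorphD mulrDl.
by case: (hid (r - i)%N) => _ hD _; apply: hD.
Qed.

Lemma graded_value_sum (J : Type) (l : seq J) (P : pred J) r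
    (c : J -> A) (z : J -> B) :
  (forall i, P i -> G r (c i) (z i)) ->
  G r (\sum_(i <- l | P i) c i) (\sum_(i <- l | P i) z i).
Proof.
move=> h; apply: (big_ind2 (G r)) => //; first exact: graded_value0.
by move=> *; apply: graded_valueD.
Qed.

Lemma graded_value_monomial r k a : (k <= r)%N -> I (r - k)%N a ->
  G r (a *+ (k == r)) (f a * u ^+ k).
Proof.
move=> le_kr Ia; case: hI => hid _ _.
exists (fun i : 'I_r.+1 => a *+ (k == i)); split=> // [|i].
  rewrite (bigD1 (Ordinal (le_kr : k < r.+1)%N)) //= eqxx mulr1n.
  rewrite big1 ?addr0 // => i; rewrite -val_eqE /= eq_sym => /negPf ->.
  by rewrite rmorph0 mul0r.
case: eqP => [<- //|_]; rewrite mulr0n.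
by case: (hid (r - i)%N).
Qed.

(** Expanding both factors into monomials leaves one contribution to the
    coefficient at [u^(r + s)], that of the two top monomials: for [k <= r]
    and [l <= s], [k + l = r + s] forces [k = r] and [l = s]. *)
Lemma graded_valueM r s c d z w :
  G r c z -> G s d w -> G (r + s)%N (c * d) (z * w).
Proof.
case=> [a [<- <- Ia]] [b [<- <- Ib]].
have top t (e : 'I_t.+1 -> A) :
    e ord_max = \sum_(k < t.+1) e k *+ (k == t :> nat).
  rewrite (bigD1 ord_max) //= eqxx mulr1n big1 ?addr0 // => i.
  by rewrite -val_eqE /= => /negPf ->.
rewrite (top _ a) (top _ b) !mulr_suml.
apply: graded_value_sum => k _; rewrite !mulr_sumr.
apply: graded_value_sum => l _.
have le_k : (k <= r)%N by rewrite -ltnS.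
have le_l : (l <= s)%N by rewrite -ltnS.
have -> : a k *+ (k == r :> nat) * (b l *+ (l == s :> nat))
    = (a k * b l) *+ (k + l == r + s)%N.
  rewrite mulrnAl mulrnAr -mulrnA mulnb andbC.
  by case: (leqif_add (leqif_eq le_k) (leqif_eq le_l)) => _ ->.
rewrite mulrACA -rmorphM -exprD.
apply: graded_value_monomial; first exact: leq_add.
have -> : (r + s - (k + l) = (r - k) + (s - l))%N.
  by rewrite subnDA -addnBAC // addnBA.
exact: semifiltrationM.
Qed.

Lemma graded_value_const a : G 0 a (f a).
Proof.
case: hI => _ h0 _.
by have := @graded_value_monomial 0 0 a isT (h0 a); rewrite expr0 mulr1.
Qed.

Lemma graded_value_prod r n (c : 'I_n -> A) (z : 'I_n -> B) :
  (forall i, G r (c i) (z i)) ->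
  G (n * r)%N (\prod_(i < n) c i) (\prod_(i < n) z i).
Proof.
elim: n c z => [|n IHn] c z h.
  by rewrite !big_ord0 -(rmorph1 f); apply: graded_value_const.
by rewrite !big_ord_recl mulSn; apply: graded_valueM => //; apply: IHn.
Qed.

Lemma graded_value_det r n (L : 'M[A]_n) (D : 'M[B]_n) :
  (forall i j, G r (L i j) (D i j)) -> G (n * r)%N (\det L) (\det D).
Proof.
move=> h; apply: graded_value_sum => s _.
rewrite -[(n * r)%N]add0n; apply: graded_valueM; last exact: graded_value_prod.
by rewrite -(rmorph_sign f); apply: graded_value_const.
Qed.

End GradedValue.

(** * The matrix attached to an integral element *)

(** The companion matrix of the equation of [y]: its last row holds the
    coefficients of [y^n], the others shift the powers of [y]. *)
Lemma n_integral_companion (A B : comPzRingType) (f : {rmorphism A -> B})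
    (n : nat) (y : B) : n_integral f n y ->
  exists C : 'M[A]_n, map_mx f C *m (\col_i y ^+ i) = y *: (\col_i y ^+ i).
Proof.
case=> a ya.
exists (\matrix_(i, j) if (i.+1 == n)%N then - a j else (i.+1 == j :> nat)%:R).
apply/matrixP => i j; rewrite !mxE -exprS.
have [iS|neq_in] := eqVneq i.+1 n.
  rewrite iS -(addr0_eq (etrans (addrC _ _) ya)) -sumrN.
  apply: eq_bigr => k _.
  by rewrite !mxE iS eqxx rmorphN mulNr.
have lt_in : (i.+1 < n)%N by rewrite ltn_neqAle neq_in ltn_ord.
rewrite (bigD1 (Ordinal lt_in)) //= !mxE (negPf neq_in) /= eqxx rmorph1 mul1r.
rewrite big1 ?addr0 // => k; rewrite -val_eqE /= eq_sym => /negPf ne_k.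
by rewrite !mxE (negPf neq_in) ne_k rmorph0 mul0r.
Qed.

(** Multiplication by the adjugate turns [D v = 0] into [det D * v = 0]; for
    [n = 0] the equation of [y] says that [B] is the zero ring. *)
Lemma det_annihilating_powers (A B : comPzRingType) (f : {rmorphism A -> B})
    (n : nat) (y : B) (D : 'M[B]_n) :
  n_integral f n y -> D *m (\col_i y ^+ i) = 0 -> \det D = 0.
Proof.
case: n D => [|n] D.
  by case=> a; rewrite big_ord0 addr0 expr0 => B0 _; rewrite det_mx00.
move=> _ /(congr1 (mulmx (\adj D))).
rewrite mulmxA mul_adj_mx mul_scalar_mx mulmx0 => /matrixP /(_ ord0 ord0).
by rewrite !mxE expr0 mulr1.
Qed.

Theorem theorem2p14 (A B : comPzRingType) (f : {rmorphism A -> B})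
    (I : nat -> A -> Prop) (hI : ideal_semifiltration I)
    (x y : B) (m n : nat)
    (hx : n_integral_over f I m x) (hy : n_integral f n y) :
  n_integral_over f I (n * m)%N (x * y).
Proof.
have [C yC] := n_integral_companion hy.
case: hx => a [xa a_top Ia].
set v := (\col_i y ^+ i) in yC.
pose Cpow e := iter e (mulmx C) 1%:M.
have yCpow e : map_mx f (Cpow e) *m v = y ^+ e *: v.
  elim: e => [|e IHe]; first by rewrite map_mx1 mul1mx expr0 scale1r.
  by rewrite /= map_mxM -mulmxA IHe -scalemxAr yC scalerA -exprSr.
pose D := \sum_(k < m.+1)
  (f (a k) * (x * y) ^+ k) *: map_mx f (Cpow (m - k)%N).
have Dv0 : D *m v = 0.
  (* each term carries the full power [y ^+ m] *)
  have term (k : 'I_m.+1) :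
      (f (a k) * (x * y) ^+ k) *: map_mx f (Cpow (m - k)%N) *m v
      = (f (a k) * x ^+ k * y ^+ m) *: v.
    have le_km : (k <= m)%N by rewrite -ltnS.
    rewrite -scalemxAl yCpow scalerA exprMn.
    by rewrite mulrA -[in LHS]mulrA -exprD subnKC.
  rewrite mulmx_suml (eq_bigr _ (fun k _ => term k)).
  by rewrite -scaler_suml -mulr_suml xa mul0r scale0r.
have := @graded_value_det _ _ f I hI (x * y) m n 1%:M D.
rewrite det1 (det_annihilating_powers hy Dv0); apply => i j.
have -> : D i j
    = \sum_(k < m.+1) f (a k * Cpow (m - k)%N i j) * (x * y) ^+ k.
  by rewrite summxE; apply: eq_bigr => k _; rewrite !mxE rmorphM mulrAC.
exists (fun k : 'I_m.+1 => a k * Cpow (m - k)%N i j); split=> // [|k].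
  by rewrite a_top mul1r /= subnn.
case: hI => hid _ _; case: (hid (m - k)%N) => _ _ hZ.
by rewrite mulrC; apply: hZ.
Qed.
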